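(* Let $q\neq 0$ be a real number and let $\gamma$ be an arclength parametrized contact magnetic curve of strength $q$ in $\mathrm{SL}_2\mathbb{R}$ whose projection $\beta=\pi\circ\gamma$ to $\mathbb{H}^2(-4)$ is a regular curve. Then $\gamma$ is a geodesic of the Hopf tube $H_\beta$ over $\beta$; that is, $\gamma$ lies in $H_\beta$ and is a geodesic of $H_\beta$ with respect to the Riemannian metric induced on $H_\beta$ by $g$.
   Context: Coordinates and metric: every element of $\mathrm{SL}_2\mathbb{R}$ is written uniquely as $$\begin{pmatrix}1&x\\0&1\end{pmatrix}\begin{pmatrix}\sqrt y&0\\0&1/\sqrt y\end{pmatrix}\begin{pmatrix}\cos\theta&\sin\theta\\-\sin\theta&\cos\theta\end{pmatrix},\quad x\in\mathbb{R},\ y>0,\ \theta\in\mathbb{R}/2\pi\mathbb{Z},$$ and $(x,y,\theta)$ are used as global coordinates. $\mathrm{SL}_2\mathbb{R}$ carries the Riemannian metric $$g=\frac{dx^2+dy^2}{4y^2}+\Big(d\theta+\frac{dx}{2y}\Big)^2 .$$ A $g$-orthonormal frame is $\epsilon_1=2y\,\partial_x-\partial_\theta$, $\epsilon_2=2y\,\partial_y$, $\epsilon_3=\partial_\theta$. The canonical Sasakian structure is $(\varphi,\xi,\eta,g)$ with $\eta=d\theta+\frac{dx}{2y}$, $\xi=\epsilon_3$, $\varphi\epsilon_1=\epsilon_2$, $\varphi\epsilon_2=-\epsilon_1$, $\varphi\epsilon_3=0$. A contact magnetic curve of strength $q$ is a curve $\gamma$ satisfying $\nabla_{\gamma'}\gamma'=q\,\varphi\gamma'$,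 where $\nabla$ is the Levi-Civita connection of $g$. $\mathbb{H}^2(-4)$ is the upper half plane $\{(x,y): y>0\}$ with metric $\frac{dx^2+dy^2}{4y^2}$, and $\pi:\mathrm{SL}_2\mathbb{R}\to\mathbb{H}^2(-4)$, $\pi(x,y,\theta)=(x,y)$, is the hyperbolic Hopf fibering (a Riemannian submersion). For a regular curve $\beta$ in $\mathbb{H}^2(-4)$, reparametrized by arclength as $\beta(u)=(x(u),y(u))$, the Hopf tube $H_\beta=\pi^{-1}(\beta)$ is the immersed surface $F(t,u)=(x(u),y(u),\theta(u)+t)$, where $(x(u),y(u),\theta(u))$ is a horizontal lift of $\beta$, i.e. a lift of $\beta$ whose velocity is annihilated by $\eta$. A curve $\gamma$ is a geodesic of $H_\beta$ if $\gamma=F\circ c$ for a geodesic $c$ of the pulled-back metric $F^*g$. *)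

(* Defs.v *)
From HB Require Import structures.
From mathcomp Require Import all_boot all_order all_algebra.
From mathcomp Require Import all_classical all_reals all_analysis.
From mathcomp Require Import ring.
Set Implicit Arguments.
Unset Strict Implicit.
Unset Printing Implicit Defensive.
Import Order.TTheory GRing.Theory Num.Theory.
Import numFieldNormedType.Exports.
Local Open Scope ring_scope.
Local Open Scope classical_set_scope.

Definition open_interval (R : realType) (I : set R) : Prop :=
  [/\ open I, is_interval I & I !=set0].

(* C^infinity; [I] is always open here, so that the (total, two-sided)
   derivatives at points of [I] only depend on [f] restricted to [I]. *)
Definition smooth_on (R : realType) (V : normedModType R) (I : set R)
    (f : R -> V) : Prop :=
  forall (n : nat) (t : R), I t -> derivable (f^`(n)) t 1.

Definition reparametrization (R : realType) (J I : set R) (sigma : R -> R)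
    : Prop :=
  [/\ open_interval J, smooth_on J sigma, set_bij J I sigma
    & forall u, J u -> sigma^`() u != 0].

(* [g p v w] is the inner product at the point [p] of the tangent vectors whose
   components in the coordinate frame are the entries of [v] and [w]. *)
Definition metric (R : realType) (n : nat) : Type :=
  'rV[R]_n -> 'rV[R]_n -> 'rV[R]_n -> R.

Definition dd (R : realType) (n : nat) (i : 'I_n) : 'rV[R]_n := delta_mx 0 i.
Arguments dd {R n} i.

Definition gram (R : realType) (n : nat) (g : metric R n) (p : 'rV[R]_n)
    : 'M[R]_n :=
  \matrix_(i, j) g p (dd i) (dd j).

(* Gamma^k_{ij} of the Levi-Civita connection:
   (1/2) g^{kl} (d_i g_{jl} + d_j g_{il} - d_l g_{ij}). *)
Definition christoffel (R : realType) (n : nat) (g : metric R n)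
    (k i j : 'I_n) (p : 'rV[R]_n) : R :=
  2^-1 * \sum_(l < n) invmx (gram g p) k l *
    ('D_(dd i) (fun z => gram g z j l) p
     + 'D_(dd j) (fun z => gram g z i l) p
     - 'D_(dd l) (fun z => gram g z i j) p).

(* nabla_{c'} c' along the curve [c]. *)
Definition cov_accel (R : realType) (n : nat) (g : metric R n)
    (c : R -> 'rV[R]_n) (t : R) : 'rV[R]_n :=
  let v := c^`() t in
  let a := c^`(2) t in
  \row_(k < n) (a 0 k
    + \sum_(i < n) \sum_(j < n) christoffel g k i j (c t) * v 0 i * v 0 j).

Definition geodesic (R : realType) (n : nat) (g : metric R n) (I : set R)
    (c : R -> 'rV[R]_n) : Prop :=
  forall t, I t -> cov_accel g c t = 0.

Definition unit_speed (R : realType) (n : nat) (g : metric R n) (I : set R)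
    (c : R -> 'rV[R]_n) : Prop :=
  forall t, I t -> g (c t) (c^`() t)%classic (c^`() t)%classic = 1.

Definition regular (R : realType) (n : nat) (I : set R) (c : R -> 'rV[R]_n)
    : Prop :=
  forall t, I t -> c^`() t != 0.

(* The differential of [F] at [p] maps [v] to ['D_v F p]. *)
Definition pullback (R : realType) (m n : nat) (F : 'rV[R]_m -> 'rV[R]_n)
    (g : metric R n) : metric R m :=
  fun p v w => g (F p) ('D_v F p) ('D_w F p).

Definition mx22 (R : realType) (a b c d : R) : 'M[R]_2 :=
  \matrix_(i < 2, j < 2) nth 0 (nth [::] [:: [:: a; b]; [:: c; d]] i) j.

(* The angle, defined modulo 2 pi on SL_2(R), is represented by a real number;
   [sl2_point] is the quotient map. *)
Definition sl2_point (R : realType) (p : 'rV[R]_3) : 'M[R]_2 :=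
  let x := p 0 0 in let y := p 0 1 in let th := p 0 2 in
  mx22 1 x 0 1
  *m mx22 (Num.sqrt y) 0 0 (Num.sqrt y)^-1
  *m mx22 (cos th) (sin th) (- sin th) (cos th).

(* [gamma] is a smooth curve in SL_2(R), and the components of [p] are smooth
   coordinate functions of it (with a continuous choice of the angle, which
   exists along every smooth curve defined on an interval). *)
Definition sl2_curve (R : realType) (I : set R) (gamma : R -> 'M[R]_2)
    (p : R -> 'rV[R]_3) : Prop :=
  smooth_on I p /\
  forall t, I t -> 0 < p t 0 1 /\ gamma t = sl2_point (p t).

(* eta = d theta + dx / (2 y) *)
Definition eta (R : realType) (p v : 'rV[R]_3) : R :=
  v 0 2 + v 0 0 / (2 * p 0 1).

Definition sl2_metric (R : realType) : metric R 3 := fun p v w =>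
  (v 0 0 * w 0 0 + v 0 1 * w 0 1) / (4 * p 0 1 ^+ 2) + eta p v * eta p w.

Definition eps1 (R : realType) (p : 'rV[R]_3) : 'rV[R]_3 :=
  (2 * p 0 1) *: dd 0 - dd 2.
Definition eps2 (R : realType) (p : 'rV[R]_3) : 'rV[R]_3 :=
  (2 * p 0 1) *: dd 1.
Definition eps3 (R : realType) (p : 'rV[R]_3) : 'rV[R]_3 := dd 2.

(* The endomorphism field determined by phi eps1 = eps2, phi eps2 = - eps1 and
   phi eps3 = 0: the components of [v] in the orthonormal frame are its inner
   products with the frame vectors. *)
Definition phi (R : realType) (p v : 'rV[R]_3) : 'rV[R]_3 :=
  sl2_metric p v (eps1 p) *: eps2 p - sl2_metric p v (eps2 p) *: eps1 p.

Definition contact_magnetic (R : realType) (q : R) (I : set R)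
    (p : R -> 'rV[R]_3) : Prop :=
  forall t, I t ->
    cov_accel (@sl2_metric R) p t = q *: phi (p t) (p^`() t)%classic.

Definition hyp_metric (R : realType) : metric R 2 := fun p v w =>
  (v 0 0 * w 0 0 + v 0 1 * w 0 1) / (4 * p 0 1 ^+ 2).

Definition hopf_proj (R : realType) (p : 'rV[R]_3) : 'rV[R]_2 :=
  \row_(i < 2) [:: p 0 0; p 0 1]`_i.

Definition hopf_tube_set (R : realType) (I : set R) (beta : R -> 'rV[R]_2)
    : set 'M[R]_2 :=
  [set A | exists p : 'rV[R]_3, exists s : R,
    [/\ 0 < p 0 1, A = sl2_point p, I s & hopf_proj p = beta s]].

Definition horizontal_lift (R : realType) (J : set R) (b : R -> 'rV[R]_2)
    (l : R -> 'rV[R]_3) : Prop :=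
  [/\ smooth_on J l, forall u, J u -> hopf_proj (l u) = b u
    & forall u, J u -> eta (l u) (l^`() u)%classic = 0].

(* F(t, u) = (x(u), y(u), theta(u) + t), where [l] = (x, y, theta). *)
Definition hopf_tube (R : realType) (l : R -> 'rV[R]_3) (tu : 'rV[R]_2)
    : 'rV[R]_3 :=
  l (tu 0 1) + tu 0 0 *: dd 2.

(* [l] is a horizontal lift of an arclength reparametrization, defined on [J],
   of the curve [beta] : I -> H^2(-4), so that [hopf_tube l], on the domain of
   the (t, u) with u in [J], parametrizes the Hopf tube over [beta]. *)
Definition hopf_tube_generator (R : realType) (I : set R)
    (beta : R -> 'rV[R]_2) (J : set R) (l : R -> 'rV[R]_3) : Prop :=
  exists sigma : R -> R,
    [/\ reparametrization J I sigma,
        unit_speed (@hyp_metric R) J (beta \o sigma)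
      & horizontal_lift J (beta \o sigma) l].

(* The Hopf tube over [beta] has such parametrizations, and [gamma] is a
   geodesic of the induced metric in each of them. *)
Definition geodesic_of_hopf_tube (R : realType) (I : set R)
    (beta : R -> 'rV[R]_2) (gamma : R -> 'M[R]_2) : Prop :=
  (exists (J : set R) (l : R -> 'rV[R]_3), hopf_tube_generator I beta J l) /\
  forall (J : set R) (l : R -> 'rV[R]_3), hopf_tube_generator I beta J l ->
    exists c : R -> 'rV[R]_2,
      [/\ smooth_on I c,
          forall s, I s -> J (c s 0 1),
          forall s, I s -> gamma s = sl2_point (hopf_tube l (c s))
        & geodesic (pullback (hopf_tube l) (@sl2_metric R)) I c].

Lemma det_mx22 (R : realType) (a b c d : R) :
  \det (mx22 a b c d) = a * d - b * c.
Proof.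
rewrite (expand_det_row _ 0) !big_ord_recl big_ord0 /cofactor !det_mx11 !mxE /=.
by rewrite expr0 expr1; ring.
Qed.

Lemma det_sl2_point (R : realType) (p : 'rV[R]_3) :
  0 < p 0 1 -> \det (sl2_point p) = 1.
Proof.
move=> y0; rewrite /sl2_point !det_mulmx !det_mx22.
rewrite !mulr0 !subr0 mulr1 mul1r divff ?mul1r ?sqrtr_eq0 -?ltNge //.
by rewrite mulrN opprK -!expr2 cos2Dsin2.
Qed.

Lemma sl2_frame_orthonormal (R : realType) (p : 'rV[R]_3) : 0 < p 0 1 ->
  let e := fun i : 'I_3 => nth 0 [:: eps1 p; eps2 p; eps3 p] i in
  forall i j, sl2_metric p (e i) (e j) = (i == j)%:R.
Proof.
move=> y0 e i j; have yn0 : p 0 1 != 0 by rewrite gt_eqF.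
rewrite /e; case: i => [[|[|[|//]]] ?]; case: j => [[|[|[|//]]] ?];
  rewrite /= /sl2_metric /eta /eps1 /eps2 /eps3 /dd !mxE /=; by field.
Qed.

Lemma phi_frame (R : realType) (p : 'rV[R]_3) : 0 < p 0 1 ->
  [/\ phi p (eps1 p) = eps2 p, phi p (eps2 p) = - eps1 p & phi p (eps3 p) = 0].
Proof.
move=> y0; have h := sl2_frame_orthonormal y0.
have := h 0 0; have := h 0 1; have := h 1 0; have := h 1 1.
have := h 2 0; have := h 2 1; rewrite /phi /= => -> -> -> -> -> ->.
by rewrite /= !scale0r !scale1r subr0 sub0r subrr.
Qed.

(* Main.v *)
Require Import Defs.
From mathcomp Require Import all_boot all_order all_algebra.
From mathcomp Require Import all_classical all_reals all_analysis.
From mathcomp Require Import ring.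
Import Order.TTheory GRing.Theory Num.Theory.
Import numFieldNormedType.Exports.
Local Open Scope ring_scope.
Local Open Scope classical_set_scope.

(** The Hopf tube is a flat surface on which the magnetic curve is a straight
    line, and that is the whole proof.

    In the parametrization [hopf_tube l], where [l] is a horizontal lift of the
    base curve parametrized by arclength, the induced metric is [dt^2 + du^2]:
    the fibre direction is a unit vector orthogonal to the horizontal unit
    vector [l'], and the fibration is a Riemannian submersion
    ([pullback_hopf_tube]). The Christoffel symbols therefore vanish, and the
    geodesics are the affine curves ([cov_accel_const_gram]).

    The coordinates [(t, u)] of the magnetic curve [p] on its tube are affine
    in arclength for the following reason. The metric does not depend on the
    angle and the Lorentz force [phi p'] is horizontal, so Noether's theorem for
    the fibre rotation makes [eta p'] a constant [C] ([magnetic_eta_const]). As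
    [p] has unit speed, its projection then has the constant squared speed
    [1 - C^2], which is positive because the projection is regular. Hence the
    arclength [u] of the projection is an affine function of the parameter of
    [p] ([arclength_reparametrization_affine]), and since [l] is horizontal the
    angle between [p] and [l] has the constant derivative
    [C] ([lift_angle]). *)

(** * Derivatives of curves and matrices *)

Lemma derive1_eq {R : realType} {V : normedModType R} {f : R -> V} {t : R}
    {d : V} : is_derive t 1 f d -> (f^`() t)%classic = d.
Proof. by move=> [_ <-]; rewrite derive1E. Qed.

Lemma is_derive_unique {R : realType} {V W : normedModType R} {f : V -> W}
    {x v : V} {a b : W} : is_derive x v f a -> is_derive x v f b -> a = b.
Proof. by move=> [_ <-] [_ <-]. Qed.

Lemma is_derive_entry {R : realType} {V : normedModType R} {m n : nat}
    {M : V -> 'M[R]_(m, n)} {x v : V} {dM : 'M[R]_(m, n)} i j :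
  is_derive x v M dM -> is_derive x v (fun t => M t i j) (dM i j).
Proof.
move=> [Mx <-]; rewrite (derive_mx Mx) mxE.
by apply: derivableP; exact: ((derivable_mxP M x v).1 Mx i j).
Qed.

Lemma is_derive_mx {R : realType} {V : normedModType R} {m n : nat}
    {M : V -> 'M[R]_(m, n)} {x v : V} {dM : 'M[R]_(m, n)} :
  (forall i j, is_derive x v (fun t => M t i j) (dM i j)) ->
  is_derive x v M dM.
Proof.
move=> h.
have Mx : derivable M x v by apply/derivable_mxP => i j; case: (h i j).
apply: DeriveDef => //; rewrite (derive_mx Mx); apply/matrixP => i j.
by rewrite mxE; exact: derive_val.
Qed.

Lemma is_derive_rV_comp {R : realType} {n : nat} {f : R -> 'rV[R]_n}
    {sigma : R -> R} {u s : R} {df : 'rV[R]_n} :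
  is_derive (sigma u) 1 f df -> is_derive u 1 sigma s ->
  is_derive u 1 (f \o sigma) (s *: df).
Proof.
move=> hf hs; apply: is_derive_mx => i j; rewrite mxE mulrC.
have hfij : is_derive (sigma u) 1 (fun t => f t i j : R) (df i j).
  exact: is_derive_entry.
exact: (@is_derive1_comp R (fun t => f t i j : R) sigma u _ _ hfij hs).
Qed.

Lemma is_derive_eq_on {R : realType} {V : normedModType R} {I : set R}
    (f : R -> V) {g : R -> V} {t : R} {d : V} :
  open I -> I t -> (forall u, I u -> f u = g u) ->
  is_derive t 1 f d -> is_derive t 1 g d.
Proof.
move=> oI It fg; apply: (near_eq_is_derive (f := f)).
near=> u; apply: fg; near: u.
exact: open_nbhs_nbhs.
Unshelve. all: by end_near. Qed.

Lemma is_derive_along {R : realType} {V W : normedModType R} {f : V -> W}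
    {x v : V} {d : W} :
  is_derive (0 : R) (1 : R) (fun h : R => f (h *: v + x)) d ->
  is_derive x v f d.
Proof.
move=> [fx <-]; apply: DeriveDef; first exact/derivable1P.
rewrite /derive; set g1 := fun h => h^-1 *: _; set g2 := fun h => h^-1 *: _.
suff -> : g1 = g2 by [].
by apply/funext => h; rewrite /g1 /g2 /= addr0 scale0r add0r [_%:A]mulr1.
Qed.

Lemma derive_invariant {R : realType} {V W : normedModType R} {f : V -> W}
    {x v : V} : (forall h : R, f (h *: v + x) = f x) -> 'D_v f x = 0.
Proof.
move=> fx; apply: derive_val; apply: is_derive_along.
rewrite (_ : (fun _ => _) = cst (f x)); first exact: is_derive_cst.
exact/funext.
Qed.

Lemma is_derive_inv2 {R : realType} {V : normedModType R} {y : V -> R}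
    {x v : V} {dy : R} : y x != 0 -> is_derive x v y dy ->
  is_derive x v (fun z => (2 * y z)^-1) (- dy / (2 * y x ^+ 2)).
Proof.
move=> yn0 hy.
have yn0' : 2 * y x != 0 by rewrite mulf_neq0 // pnatr_eq0.
have h : is_derive x v (fun z => 2 * y z : R) (2 * dy).
  exact: (@is_deriveZ _ _ _ y 2 x v dy hy).
apply: (@DeriveDef _ _ _ _ _ (fun z => (2 * y z)^-1)).
  by apply: derivableV.
by rewrite deriveV // derive_val /GRing.scale /=; field.
Qed.

Lemma derive0_eq_on {R : realType} {I : set R} {f : R -> R} :
  is_interval I -> (forall t, I t -> is_derive t 1 f 0) ->
  forall s t, I s -> I t -> f s = f t.
Proof.
move=> iI df s t Is It; wlog st : s t Is It / s <= t.
  by move=> H; case: (leP s t) => [|/ltW] /H // -> .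
have sub x : x \in `[s, t]%R -> I x.
  by rewrite in_itv /= => ?; exact: iI Is It _ _.
have [||c _] := MVT_segment (df := fun=> 0) st (f := f).
- by move=> x xi; apply/df/sub; exact: subset_itv_oo_cc xi.
- apply: derivable_within_continuous => x xi.
  by have [] := df x (sub x xi).
by rewrite mul0r => /eqP; rewrite subr_eq0 => /eqP.
Qed.

(** * Smooth curves and straight lines *)

Lemma smooth_is_derive {R : realType} {V : normedModType R} {I : set R}
    {f : R -> V} (n : nat) {t : R} :
  smooth_on I f -> I t -> is_derive t 1 (f^`(n)) (f^`(n.+1) t).
Proof.
by move=> sf It; rewrite derive1nS derive1E; apply: derivableP; exact: sf.
Qed.

(** Iterated derivatives taken over the whole line only satisfy the rules of
    calculus on [I]; a sequence of candidate derivatives lets smoothness be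
    checked by first order rules at points of [I]. *)
Lemma smooth_on_jet {R : realType} {V : normedModType R} {I : set R}
    (D : nat -> R -> V) :
  open I -> (forall n t, I t -> is_derive t 1 (D n) (D n.+1 t)) ->
  smooth_on I (D 0).
Proof.
move=> oI hD.
have E n : forall t, I t -> (D 0)^`(n) t = D n t.
  elim: n => [//|n IH] t It.
  rewrite derive1nS; apply: derive1_eq.
  apply: (is_derive_eq_on (D n) oI It); last exact: hD.
  by move=> u Iu; rewrite IH.
move=> n t It.
have h : is_derive t 1 ((D 0)^`(n)) (D n.+1 t).
  by apply: (is_derive_eq_on (D n) oI It) (hD n t It) => u Iu; rewrite E.
by case: h.
Qed.

Lemma is_derive_line {R : realType} {V : normedModType R} (w b : V) (t : R) :
  is_derive t 1 (fun s : R => s *: w + b) w.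
Proof.
have h : is_derive t 1 (fun s : R => s *: w) w.
  apply: DeriveDef; first exact: diff_derivable.
  by rewrite deriveE // diff_val scale1r.
by have := is_deriveD h (is_derive_cst b t 1); rewrite addr0.
Qed.

Lemma is_derive_affine {R : realType} (a b t : R) :
  is_derive t 1 (fun s : R => a * s + b) a.
Proof.
rewrite (_ : (fun _ => _) = fun s : R => s *: a + b).
  exact: is_derive_line.
by apply/funext => s; rewrite mulrC.
Qed.

Lemma derive1_line {R : realType} {V : normedModType R} (w b : V) :
  (fun s : R => s *: w + b)^`()%classic = cst w.
Proof. by apply/funext => t; apply: derive1_eq; exact: is_derive_line. Qed.

Lemma derive1n_line {R : realType} {V : normedModType R} (w b : V) (k : nat) :
  (fun s : R => s *: w + b)^`(k.+2)%classic = cst 0.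
Proof.
elim: k => [|k IH]; apply/funext => t.
  by rewrite !derive1nS derive1n0 derive1_line; exact: derive1_eq.
by rewrite derive1nS IH; apply: derive1_eq; exact: is_derive_cst.
Qed.

Lemma smooth_line {R : realType} {V : normedModType R} (w b : V) (I : set R) :
  smooth_on I (fun s : R => s *: w + b).
Proof.
move=> [|[|k]] t _.
- by have [] := is_derive_line w b t.
- by rewrite derive1nS derive1n0 derive1_line; exact: derivable_cst.
- by rewrite derive1n_line; exact: derivable_cst.
Qed.

Lemma derive_const_affine {R : realType} {I : set R} {f : R -> R} {k : R} :
  is_interval I -> I !=set0 -> (forall t, I t -> is_derive t 1 f k) ->
  exists m, forall t, I t -> f t = k * t + m.
Proof.
move=> iI [t0 It0] df; exists (f t0 - k * t0) => t It.
have H s : I s -> is_derive s 1 (fun u => f u - (k * u + 0)) 0.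
  move=> Is; rewrite -[X in is_derive _ _ _ X](subrr k).
  exact: is_deriveB (df s Is) (is_derive_affine k 0 s).
have := derive0_eq_on iI H t t0 It It0.
by rewrite !addr0 => <-; rewrite addrC subrK.
Qed.

(** * Covariant acceleration *)

(** Lowering the free index removes the inverse Gram matrix, which leaves the
    Christoffel symbols of the first kind. *)
Lemma lower_cov_accel {R : realType} {n : nat} (g : metric R n)
    (c : R -> 'rV[R]_n) (t : R) (m : 'I_n) : gram g (c t) \in unitmx ->
  \sum_k gram g (c t) m k * cov_accel g c t 0 k =
  \sum_k gram g (c t) m k * (c^`(2) t)%classic 0 k +
  2^-1 * \sum_i \sum_j ('D_(dd i) (fun z => gram g z j m) (c t)
     + 'D_(dd j) (fun z => gram g z i m) (c t)
     - 'D_(dd m) (fun z => gram g z i j) (c t))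
     * (c^`() t)%classic 0 i * (c^`() t)%classic 0 j.
Proof.
move=> Gu.
under eq_bigr do rewrite [cov_accel _ _ _ _ _]mxE mulrDr.
rewrite big_split /=; congr (_ + _).
under eq_bigr do rewrite mulr_sumr.
rewrite exchange_big mulr_sumr; apply: eq_bigr => i _.
under eq_bigr do rewrite mulr_sumr.
rewrite exchange_big mulr_sumr; apply: eq_bigr => j _.
rewrite /christoffel; set v := (c^`() t)%classic.
set D := fun l => 'D_(dd i) (fun z => gram g z j l) (c t)
     + 'D_(dd j) (fun z => gram g z i l) (c t)
     - 'D_(dd l) (fun z => gram g z i j) (c t).
rewrite [RHS](_ : _ = 2^-1 * D m * v 0 i * v 0 j); last by rewrite /D; ring.
transitivity (2^-1 * (\sum_l (gram g (c t) *m invmx (gram g (c t))) m l * D l)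
    * v 0 i * v 0 j).
  rewrite mulr_sumr !mulr_suml.
  under [RHS]eq_bigr do rewrite mxE.
  under [RHS]eq_bigr do rewrite mulr_suml mulr_sumr !mulr_suml.
  rewrite exchange_big; apply: eq_bigr => k _.
  rewrite mulr_sumr !mulr_suml mulr_sumr; apply: eq_bigr => l _.
  by rewrite -/(D l); ring.
congr (_ * _ * _ * _); rewrite mulmxV // (bigD1 m) //= big1 => [|l lm].
  by rewrite mxE eqxx mul1r addr0.
by rewrite mxE eq_sym (negbTE lm) mul0r.
Qed.

Lemma cov_accel_const_gram {R : realType} {n : nat} {g : metric R n}
    (G : 'M[R]_n) {c : R -> 'rV[R]_n} {t : R} :
  (\forall z \near c t, gram g z = G) -> cov_accel g c t = (c^`(2) t)%classic.
Proof.
move=> gG.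
have D0 i j l : 'D_(dd l) (fun z => gram g z i j) (c t) = 0.
  rewrite (@near_eq_derive _ _ _ _ (cst (G i j))) ?derive_cst //.
  by apply: filterS gG => z ->.
apply/rowP => k; rewrite mxE big1 ?addr0 // => i _; apply: big1 => j _.
rewrite /christoffel big1 ?mulr0 ?mul0r // => l _.
by rewrite !D0 addr0 subr0 mulr0.
Qed.

(** * The contact form along a magnetic curve *)

Lemma sum_ord3 {R : realType} (F : 'I_3 -> R) : \sum_i F i = F 0 + F 1 + F 2.
Proof.
rewrite !big_ord_recl big_ord0 addr0 addrA.
by congr (F _ + F _ + F _); exact/val_inj.
Qed.

Lemma gram_sl2_unit {R : realType} {p : 'rV[R]_3} : 0 < p 0 1 ->
  gram (@sl2_metric R) p \in unitmx.
Proof.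
move=> y0; have yn0 : p 0 1 != 0 by rewrite gt_eqF.
(* The inverse Gram matrix is the sum of e e^T over an orthonormal frame. *)
pose B : 'M[R]_3 := \matrix_(i, j)
  (eps1 p 0 i * eps1 p 0 j + eps2 p 0 i * eps2 p 0 j + eps3 p 0 i * eps3 p 0 j).
suff /mulmx1_unit[] : gram (@sl2_metric R) p *m B = 1%:M by [].
apply/matrixP => i j; rewrite !mxE !big_ord_recl big_ord0 !mxE.
case: i => [[|[|[|//]]] ?]; case: j => [[|[|[|//]]] ?];
  rewrite /= /sl2_metric /eta /eps1 /eps2 /eps3 /dd !mxE /=; by field.
Qed.

(** Translations in [x] and rotations in [theta] are isometries: the
    coefficients of the metric depend on [y] only. *)
Lemma derive_gram_sl2_neq1 {R : realType} (p : 'rV[R]_3) (i j l : 'I_3) :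
  l != 1 -> 'D_(dd l) (fun z => gram (@sl2_metric R) z i j) p = 0.
Proof.
move=> l1; apply: derive_invariant => h.
rewrite !mxE /sl2_metric /eta (_ : (h *: dd l + p) 0 1 = p 0 1) //.
by rewrite !mxE /= eq_sym (negbTE l1) mulr0 add0r.
Qed.

Lemma derive_gram_sl2_theta {R : realType} (p : 'rV[R]_3) (j : 'I_3) :
  p 0 1 != 0 -> 'D_(dd 1) (fun z => gram (@sl2_metric R) z j 2) p =
  (j == 0)%:R * - (2 * p 0 1 ^+ 2)^-1.
Proof.
move=> yn0.
have [->|jn0] := eqVneq j 0.
  rewrite mul1r; apply: derive_val.
  have h : is_derive p (dd 1) (fun z : 'rV[R]_3 => (z 0 1 : R)) (@dd R 3 1 0 1).
    by apply: is_derive_entry; exact: is_derive_id.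
  have := is_derive_inv2 yn0 h.
  rewrite [X in is_derive _ _ X](_ : _ = (fun z => gram (@sl2_metric R) z 0 2)).
    by rewrite /dd mxE /= mulNr mul1r.
  apply/funext => z; rewrite mxE /sl2_metric /eta /dd !mxE /=.
  by rewrite !(mulr0, mul0r, add0r, addr0, mulr1, mul1r).
rewrite mul0r; apply: derive_invariant => h.
rewrite !mxE /sl2_metric /eta /dd !mxE /=.
by case: j jn0 => [[|[|[|//]]] ?] //= _; rewrite !(mulr0, mul0r, add0r, addr0).
Qed.

Lemma eta_cov_accel {R : realType} (c : R -> 'rV[R]_3) (t : R) : 0 < c t 0 1 ->
  eta (c t) (cov_accel (@sl2_metric R) c t) =
  eta (c t) (c^`(2) t)%classic -
    (c^`() t)%classic 0 0 * (c^`() t)%classic 0 1 / (2 * c t 0 1 ^+ 2).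
Proof.
move=> y0; have yn0 : c t 0 1 != 0 by rewrite gt_eqF.
(* eta is the covector dual to the fibre direction dd 2. *)
have E w : eta (c t) w = \sum_k gram (@sl2_metric R) (c t) 2 k * w 0 k.
  by rewrite sum_ord3 !mxE /sl2_metric /eta /dd !mxE /=; field.
rewrite !E lower_cov_accel ?gram_sl2_unit //; congr (_ + _).
rewrite !sum_ord3 !(derive_gram_sl2_neq1 _ _ _ 2) //.
rewrite !(derive_gram_sl2_neq1 _ _ _ 0) // !derive_gram_sl2_theta //=.
by field.
Qed.

Lemma is_derive_eta {R : realType} {c v : R -> 'rV[R]_3} {t : R}
    {a : 'rV[R]_3} :
  c t 0 1 != 0 -> is_derive t 1 c (v t) -> is_derive t 1 v a ->
  is_derive t 1 (fun s => eta (c s) (v s))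
    (eta (c t) a - v t 0 0 * v t 0 1 / (2 * c t 0 1 ^+ 2)).
Proof.
move=> yn0 dc dv.
have := is_deriveD (is_derive_entry 0 2 dv)
  (is_deriveM (is_derive_entry 0 0 dv)
    (is_derive_inv2 yn0 (is_derive_entry 0 1 dc))).
move=> h; apply: (is_derive_eq h); rewrite /eta /GRing.scale /=; by field.
Qed.

Lemma etaZ {R : realType} (p v : 'rV[R]_3) (k : R) :
  eta p (k *: v) = k * eta p v.
Proof. by rewrite /eta !mxE; ring. Qed.

Lemma eta_phi {R : realType} (p v : 'rV[R]_3) :
  0 < p 0 1 -> eta p (phi p v) = 0.
Proof.
move=> y0; have yn0 : p 0 1 != 0 by rewrite gt_eqF.
rewrite /eta /phi; set A := sl2_metric _ _ _; set B := sl2_metric _ _ _.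
by rewrite /eps1 /eps2 /dd !mxE /=; field.
Qed.

(** By [is_derive_eta] and [eta_cov_accel], the derivative of [eta p'] is [eta]
    of the covariant acceleration, as the fibre direction is a Killing field
    dual to [eta]; and [eta] kills the Lorentz force. *)
Lemma magnetic_eta_const {R : realType} {q : R} {I : set R}
    {p : R -> 'rV[R]_3} :
  is_interval I -> smooth_on I p -> (forall t, I t -> 0 < p t 0 1) ->
  contact_magnetic q I p ->
  forall s t, I s -> I t ->
    eta (p s) (p^`() s)%classic = eta (p t) (p^`() t)%classic.
Proof.
move=> iI sp y0 hmag; apply: (derive0_eq_on iI) => t It.
have yn0 : p t 0 1 != 0 by rewrite gt_eqF // y0.
have := is_derive_eta yn0 (smooth_is_derive 0 sp It) (smooth_is_derive 1 sp It).
by rewrite -eta_cov_accel ?y0 // (hmag t It) etaZ eta_phi ?y0 // mulr0.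
Qed.

(** * The Hopf fibering *)

Lemma is_derive_hopf_proj {R : realType} {c : R -> 'rV[R]_3} {t : R}
    {v : 'rV[R]_3} :
  is_derive t 1 c v -> is_derive t 1 (@hopf_proj R \o c) (hopf_proj v).
Proof.
move=> cv; apply: is_derive_mx => i j.
rewrite (_ : (fun _ => _) =
    fun s => c s 0 (if j == 0 then 0 else 1)); last first.
  by apply/funext => s; rewrite mxE; case: j => [[|[|//]] ?].
rewrite (_ : hopf_proj v i j = v 0 (if j == 0 then 0 else 1)).
  exact: is_derive_entry.
by rewrite mxE; case: j => [[|[|//]] ?].
Qed.

Lemma smooth_hopf_proj {R : realType} {I : set R} {p : R -> 'rV[R]_3} :
  open I -> smooth_on I p -> smooth_on I (@hopf_proj R \o p).
Proof.
move=> oI sp.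
apply: (smooth_on_jet (fun n => @hopf_proj R \o p^`(n)%classic) oI) => n t It.
exact: is_derive_hopf_proj (smooth_is_derive n sp It).
Qed.

Lemma sl2_metric_submersion {R : realType} (p v w : 'rV[R]_3) :
  sl2_metric p v w =
  hyp_metric (hopf_proj p) (hopf_proj v) (hopf_proj w) + eta p v * eta p w.
Proof. by rewrite /sl2_metric /hyp_metric !mxE. Qed.

Lemma hyp_metricZ {R : realType} (p v : 'rV[R]_2) (k : R) :
  hyp_metric p (k *: v) (k *: v) = k ^+ 2 * hyp_metric p v v.
Proof. by rewrite /hyp_metric !mxE; ring. Qed.

Lemma hyp_metric_gt0 {R : realType} {p v : 'rV[R]_2} :
  0 < p 0 1 -> v != 0 -> 0 < hyp_metric p v v.
Proof.
move=> y0 v0; rewrite /hyp_metric divr_gt0 ?mulr_gt0 ?exprn_gt0 //.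
rewrite lt_neqAle addr_ge0 -?expr2 ?sqr_ge0 // andbT eq_sym.
apply: contra v0; rewrite paddr_eq0 ?sqr_ge0 // !sqrf_eq0.
move=> /andP[/eqP v00 /eqP v01].
apply/eqP/rowP => -[[|[|//]] i]; rewrite mxE.
- by rewrite -[RHS]v00; congr (v _ _); exact/val_inj.
- by rewrite -[RHS]v01; congr (v _ _); exact/val_inj.
Qed.

Lemma fibre_translate_eq {R : realType} {P Q : 'rV[R]_3} {d : R} :
  hopf_proj P = hopf_proj Q -> P 0 2 + d = Q 0 2 -> P + d *: dd 2 = Q.
Proof.
move=> /rowP h h2; have := h 0; have := h 1; rewrite !mxE /= => h1 h0.
apply/rowP => -[[|[|[|//]]] i]; rewrite !mxE /= ?mulr0 ?addr0 ?mulr1.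
- by move: h0; congr (P _ _ = Q _ _); exact/val_inj.
- by move: h1; congr (P _ _ = Q _ _); exact/val_inj.
- by move: h2; congr (P _ _ + _ = Q _ _); exact/val_inj.
Qed.

(** * The metric of a Hopf tube *)

Lemma is_derive_hopf_tube {R : realType} {l : R -> 'rV[R]_3} {tu : 'rV[R]_2}
    {dl : 'rV[R]_3} (v : 'rV[R]_2) :
  is_derive (tu 0 1) 1 l dl ->
  is_derive tu v (hopf_tube l) (v 0 1 *: dl + v 0 0 *: dd 2).
Proof.
move=> hl; apply: is_derive_along; rewrite /hopf_tube.
set sig : R -> R := fun h => v 0 1 * h + tu 0 1.
have hs : is_derive (0 : R) (1 : R) sig (v 0 1) by exact: is_derive_affine.
have hl' : is_derive (sig 0) 1 l dl by rewrite /sig mulr0 add0r.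
have h1 := is_derive_rV_comp hl' hs.
have h2 := is_derive_line (v 0 0 *: dd 2 : 'rV[R]_3) (tu 0 0 *: dd 2) 0.
rewrite (_ : (fun _ => _) =
    (l \o sig) + (fun s : R => s *: (v 0 0 *: dd 2) + tu 0 0 *: dd 2)).
  exact: is_deriveD h1 h2.
apply/funext => h; rewrite -[RHS]/(l (sig h) + (_ + _)) /sig !mxE mulrC.
by rewrite scalerDl scalerA.
Qed.

Lemma pullback_hopf_tube {R : realType} {l : R -> 'rV[R]_3} {tu : 'rV[R]_2}
    {dl : 'rV[R]_3} (v w : 'rV[R]_2) :
  is_derive (tu 0 1) 1 l dl -> eta (l (tu 0 1)) dl = 0 ->
  hyp_metric (hopf_proj (l (tu 0 1))) (hopf_proj dl) (hopf_proj dl) = 1 ->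
  pullback (hopf_tube l) (@sl2_metric R) tu v w =
    v 0 0 * w 0 0 + v 0 1 * w 0 1.
Proof.
move=> hl hor unit; rewrite /pullback.
have dF z : 'D_z (hopf_tube l) tu = z 0 1 *: dl + z 0 0 *: dd 2.
  by apply: derive_val; exact: is_derive_hopf_tube.
have E (a b : R) : eta (hopf_tube l tu) (a *: dl + b *: dd 2) = b.
  transitivity (a * eta (l (tu 0 1)) dl + b); last by rewrite hor mulr0 add0r.
  by rewrite /eta /hopf_tube /dd !mxE /= !mulr0 !addr0; ring.
rewrite !dF sl2_metric_submersion !E.
transitivity (v 0 0 * w 0 0 + v 0 1 * w 0 1 *
    hyp_metric (hopf_proj (l (tu 0 1))) (hopf_proj dl) (hopf_proj dl)).
  by rewrite /hyp_metric /hopf_tube /dd !mxE /= !mulr0 !addr0; ring.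
by rewrite unit mulr1.
Qed.

(** * Curves with constant contact angle *)

(** Unit speed forces [sigma'^2 = 1 / k2]; differentiating this identity gives
    [2 sigma' sigma'' = 0], so that [sigma'] itself is constant. *)
Lemma arclength_reparametrization_affine {R : realType} {I J : set R}
    {b : R -> 'rV[R]_2} {sigma : R -> R} {k2 : R} :
  smooth_on I b ->
  (forall t, I t ->
    hyp_metric (b t) (b^`() t)%classic (b^`() t)%classic = k2) ->
  reparametrization J I sigma -> unit_speed (@hyp_metric R) J (b \o sigma) ->
  exists k m, k != 0 /\ forall u, J u -> sigma u = k * u + m.
Proof.
move=> sb hb [[oJ iJ neJ] ssig [sub _ _] sig0] us.
have dsig u : J u -> is_derive u 1 sigma (sigma^`()%classic u).
  exact: (smooth_is_derive 0 ssig).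
have sq u : J u -> (sigma^`()%classic u) ^+ 2 = k2^-1.
  move=> Ju; have Iu : I (sigma u) by exact: sub.
  have := us u Ju.
  rewrite (derive1_eq (is_derive_rV_comp (smooth_is_derive 0 sb Iu)
    (dsig u Ju))).
  rewrite hyp_metricZ -[b^`(1)%classic]/(b^`()%classic) hb // => h.
  have k20 : k2 != 0.
    apply/eqP => k20; move: h; rewrite k20 mulr0 => /eqP.
    by rewrite eq_sym oner_eq0.
  by apply: (mulIf k20); rewrite h mulVf.
have cst1 u : J u -> is_derive u 1 sigma^`()%classic 0.
  move=> Ju; have d2 := smooth_is_derive 1 ssig Ju.
  have h1 := is_deriveX 2 d2.
  have h2 : is_derive u 1 (sigma^`()%classic ^+ 2) 0.
    apply: (is_derive_eq_on (cst k2^-1) oJ Ju) => v Jv.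
    by rewrite /cst /= -(sq v Jv).
  have := is_derive_unique h1 h2.
  move=> /eqP; rewrite scaler_eq0 mulf_eq0 pnatr_eq0 /= expr1.
  rewrite (negbTE (sig0 u Ju)) /=.
  by move=> /eqP E; exact: (is_derive_eq d2 E).
have [u0 Ju0] := neJ.
have dsig0 u : J u -> is_derive u 1 sigma (sigma^`()%classic u0).
  by move=> Ju; rewrite (derive0_eq_on iJ cst1 u0 u) //; exact: dsig.
have [m hm] := derive_const_affine iJ neJ dsig0.
by exists (sigma^`()%classic u0), m; split; [exact: sig0 | exact: hm].
Qed.

(** Both [p \o sigma] and [l] lie over the same base curve, so the derivatives
    of their angles differ by the difference of their contact forms,
    [C * sigma' - 0]. *)
Lemma lift_angle {R : realType} {I J : set R} {p l : R -> 'rV[R]_3} {C : R}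
    {sigma : R -> R} :
  smooth_on I p ->
  (forall t, I t -> eta (p t) (p^`()%classic t) = C) ->
  open_interval J -> smooth_on J sigma -> (forall u, J u -> I (sigma u)) ->
  horizontal_lift J ((@hopf_proj R \o p) \o sigma) l ->
  exists d, forall u, J u -> l u 0 2 + (C * sigma u + d) = p (sigma u) 0 2.
Proof.
move=> sp hC [oJ iJ [u0 Ju0]] ssig JI [sl hl etal].
pose D u := p (sigma u) 0 2 - l u 0 2 - C * sigma u.
exists (D u0) => u Ju; rewrite (_ : D u0 = D u); first by rewrite /D; ring.
apply: (derive0_eq_on iJ) => {u Ju} // u Ju.
have Iu := JI u Ju.
have dsig := smooth_is_derive 0 ssig Ju.
have dl := smooth_is_derive 0 sl Ju.
have dp := is_derive_rV_comp (smooth_is_derive 0 sp Iu) dsig.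
have Ep : hopf_proj (l^`(1)%classic u) =
    hopf_proj (sigma^`(1)%classic u *: p^`(1)%classic (sigma u)).
  apply: is_derive_unique (is_derive_hopf_proj dp).
  apply: (is_derive_eq_on _ oJ Ju) (is_derive_hopf_proj dl) => v Jv /=.
  exact: hl.
have /rowP/(_ 0) := Ep; rewrite !mxE /= => E0.
have /rowP/(_ 1) := hl u Ju; rewrite !mxE /= => E1.
have := is_deriveB (is_deriveB (is_derive_entry 0 2 dp)
  (is_derive_entry 0 2 dl)) (is_deriveZ C dsig).
move=> h; apply: (is_derive_eq h).
have := hC _ Iu; have := etal u Ju.
rewrite /eta -[l^`()%classic]/(l^`(1)%classic).
rewrite -[p^`()%classic]/(p^`(1)%classic) E0 E1.
rewrite !mxE /GRing.scale /= => e1 e2; rewrite -e2.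
by rewrite -[RHS]oppr0 -e1; ring.
Qed.

Lemma geodesic_in_hopf_tube {R : realType} {I J : set R} {p l : R -> 'rV[R]_3}
    {C k2 : R} :
  open I -> smooth_on I p ->
  (forall t, I t -> eta (p t) (p^`()%classic t) = C) ->
  (forall t, I t -> hyp_metric (hopf_proj (p t))
    (hopf_proj (p^`()%classic t)) (hopf_proj (p^`()%classic t)) = k2) ->
  hopf_tube_generator I (@hopf_proj R \o p) J l ->
  exists c : R -> 'rV[R]_2,
    [/\ smooth_on I c,
        forall s, I s -> J (c s 0 1),
        forall s, I s -> hopf_tube l (c s) = p s
      & geodesic (pullback (hopf_tube l) (@sl2_metric R)) I c].
Proof.
move=> oI sp hC hk [sigma [rep us hlift]].
have speed t : I t -> hyp_metric ((@hopf_proj R \o p) t)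
    ((@hopf_proj R \o p)^`()%classic t) ((@hopf_proj R \o p)^`()%classic t)
    = k2.
  move=> It.
  by rewrite (derive1_eq (is_derive_hopf_proj (smooth_is_derive 0 sp It))) hk.
have [k [m [k0 sigE]]] :=
  arclength_reparametrization_affine (smooth_hopf_proj oI sp) speed rep us.
have [oiJ ssig [sub _ surj] _] := rep; have [oJ _ _] := oiJ.
have [d hd] := lift_angle sp hC oiJ ssig sub hlift.
have [sl hl etal] := hlift.
(* The angle from the lift is t = C s + d, and u is the inverse of sigma. *)
pose c : R -> 'rV[R]_2 := fun s =>
  s *: (\row_i [:: C; k^-1]`_i) + \row_i [:: d; - m / k]`_i.
have c0 s : c s 0 0 = C * s + d by rewrite !mxE /= mulrC.
have c1 u : J u -> c (sigma u) 0 1 = u.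
  by move=> Ju; rewrite !mxE /= sigE //; field.
exists c; split.
- exact: smooth_line.
- by move=> s /surj[u Ju <-]; rewrite c1.
- move=> s /surj[u Ju <-]; rewrite /hopf_tube c1 // c0.
  by apply: fibre_translate_eq; [exact: hl | exact: hd].
- move=> s /surj[u Ju <-].
  rewrite (cov_accel_const_gram 1%:M) ?derive1n_line //.
  have nJ : nbhs (c (sigma u)) [set z : 'rV[R]_2 | J (z 0 1)].
    have := @coord_continuous R 1 2 0 1 (c (sigma u)); apply.
    by apply: open_nbhs_nbhs; split => //; rewrite c1.
  apply: filterS nJ => z Jz; apply/matrixP => i j.
  have dl := smooth_is_derive 0 sl Jz.
  rewrite mxE (pullback_hopf_tube _ _ dl (etal _ Jz)).
    by case: i => [[|[|//]] ?]; case: j => [[|[|//]] ?];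
      rewrite !mxE /= ?(mulr0, mulr1, addr0, add0r).
  rewrite hl //; have := us _ Jz.
  suff -> : ((@hopf_proj R \o p) \o sigma)^`()%classic (z 0 1) =
      hopf_proj (l^`(1)%classic (z 0 1)) by [].
  apply: derive1_eq.
  by apply: (is_derive_eq_on _ oJ Jz) (is_derive_hopf_proj dl).
Qed.

(** The arclength parameter is [u = sqrt k2 * s], and rotating [p] back by the
    angle [C s] that it accumulates in the fibre makes it horizontal. *)
Lemma hopf_tube_generator_exists {R : realType} {I : set R}
    {p : R -> 'rV[R]_3} {C k2 : R} :
  open_interval I -> smooth_on I p ->
  (forall t, I t -> eta (p t) (p^`()%classic t) = C) -> 0 < k2 ->
  (forall t, I t -> hyp_metric (hopf_proj (p t))
    (hopf_proj (p^`()%classic t)) (hopf_proj (p^`()%classic t)) = k2) ->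
  exists (J : set R) (l : R -> 'rV[R]_3),
    hopf_tube_generator I (@hopf_proj R \o p) J l.
Proof.
move=> [oI iI [t0 It0]] sp hC k20 hk.
pose a : R := (Num.sqrt k2)^-1.
have a0 : 0 < a by rewrite invr_gt0 sqrtr_gt0.
have an0 : a != 0 by rewrite gt_eqF.
pose sigma (u : R) : R := a * u.
have dsig (u : R) : is_derive u 1 sigma a.
  rewrite (_ : sigma = fun s : R => a * s + 0); first exact: is_derive_affine.
  by apply/funext => s; rewrite addr0.
have csig : continuous sigma.
  move=> u; apply/differentiable_continuous/derivable1_diffP.
  by have [] := dsig u.
pose J := sigma @^-1` I.
have oJ : open J by apply: open_comp => // u _; exact: csig.
pose w : 'rV[R]_3 := (- (C * a)) *: dd 2.
pose l (u : R) : 'rV[R]_3 := p (sigma u) + u *: w.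
pose D n u : 'rV[R]_3 :=
  a ^+ n *: p^`(n)%classic (sigma u) + (fun s : R => s *: w + 0)^`(n)%classic u.
have dD n u : J u -> is_derive u 1 (D n) (D n.+1 u).
  move=> Ju; apply: is_deriveD.
    rewrite exprSr -scalerA; apply: is_deriveZ.
    exact: (is_derive_rV_comp (smooth_is_derive n sp Ju)).
  by apply: (smooth_is_derive (I := setT)) => //; exact: smooth_line.
have lE : l = D 0.
  by apply/funext => u; rewrite /D expr0 scale1r derive1n0 /= addr0.
have dl u : J u -> is_derive u 1 l (a *: p^`()%classic (sigma u) + w).
  move=> Ju; rewrite lE; apply: (is_derive_eq (dD 0 u Ju)).
  by rewrite /D expr1; congr (_ + _); rewrite derive1n1 derive1_line.
exists J, l, sigma; split.
- split.
  + split=> //.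
      move=> x y Jx Jy z /andP[xz zy]; apply: (iI _ _ Jx Jy).
      by rewrite !ler_pM2l // xz zy.
    by exists (a^-1 * t0); rewrite /J /= /sigma mulVKf.
  + rewrite (_ : sigma = fun s : R => s *: a + 0); first exact: smooth_line.
    by apply/funext => s; rewrite addr0 /sigma mulrC.
  + split => //.
      by move=> u v _ _ /mulfI; apply.
    by move=> t It; exists (a^-1 * t); rewrite /J /= /sigma mulVKf.
  + by move=> u Ju; rewrite (derive1_eq (dsig u)).
- move=> u Ju.
  have dproj := is_derive_hopf_proj (smooth_is_derive 0 sp Ju).
  rewrite (derive1_eq (is_derive_rV_comp dproj (dsig u))).
  by rewrite hyp_metricZ hk // /a exprVn sqr_sqrtr ?ltW // mulVf // gt_eqF.
- split.
  + by rewrite lE; apply: smooth_on_jet.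
  + by move=> u Ju; apply/rowP => i; rewrite !mxE /= !mulr0 !addr0.
  + move=> u Ju; rewrite (derive1_eq (dl u Ju)).
    transitivity (a * (eta (p (sigma u)) (p^`()%classic (sigma u)) - C)).
      by rewrite /eta /w /l /dd !mxE /= !mulr0 !addr0; ring.
    by rewrite hC // subrr mulr0.
Qed.

(** * Magnetic curves are geodesics of Hopf tubes *)

Theorem theorem4p1 (R : realType) (q : R) (I : set R)
    (gamma : R -> 'M[R]_2) (p : R -> 'rV[R]_3)
    (hq : q != 0)
    (hI : open_interval I)
    (hgamma : sl2_curve I gamma p)
    (harc : unit_speed (@sl2_metric R) I p)
    (hmag : contact_magnetic q I p)
    (hreg : regular I (@hopf_proj R \o p)) :
  (forall s, I s -> hopf_tube_set I (@hopf_proj R \o p) (gamma s)) /\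
  geodesic_of_hopf_tube I (@hopf_proj R \o p) gamma.
Proof.
have [sp hp] := hgamma; have [oI iI [s0 Is0]] := hI.
have y0 t : I t -> 0 < p t 0 1 by move=> /hp[].
split; first by move=> s Is; have [ys gs] := hp s Is; exists (p s), s; split.
set C := eta (p s0) (p^`()%classic s0).
have hC t : I t -> eta (p t) (p^`()%classic t) = C.
  by move=> It; exact: (magnetic_eta_const iI sp y0 hmag).
have hk t : I t -> hyp_metric (hopf_proj (p t))
    (hopf_proj (p^`()%classic t)) (hopf_proj (p^`()%classic t)) = 1 - C ^+ 2.
  by move=> It; rewrite -(harc t It) sl2_metric_submersion hC // expr2 addrK.
have k0 : 0 < 1 - C ^+ 2.
  rewrite -(hk s0 Is0); apply: hyp_metric_gt0; first by rewrite mxE; exact: y0.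
  have := hreg s0 Is0.
  by rewrite (derive1_eq (is_derive_hopf_proj (smooth_is_derive 0 sp Is0))).
split; first exact: (hopf_tube_generator_exists hI sp hC k0 hk).
move=> J l gen; have [c [sc Jc cE geo]] := geodesic_in_hopf_tube oI sp hC hk gen.
by exists c; split => // s Is; rewrite cE //; have [] := hp s Is.
Qed.
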